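(* For any $t,N\in\mathbb{N}$ there are $K,n_0\in\mathbb{N}$ such that if $\mathcal{F}\subset[m]^n$ is $(t-1)$-avoiding with $n\ge n_0$ and $m\ge 2^{n/N}$, then there exists a subcube $D$ of co-dimension $t$ such that $\mu(\mathcal{F}\setminus D)\le 2^{-n/K}m^{-t}$.
   Context: $\mu$ is the uniform probability measure on $[m]^n$; $\mathcal{F}$ is $(t-1)$-avoiding if no $x,y\in\mathcal{F}$ satisfy $|\{i:x_i=y_i\}|=t-1$. A subcube of co-dimension $t$ is a set $\{x\in[m]^n:x_R=\alpha\}$ with $R\subset[n]$, $|R|=t$, $\alpha\in[m]^R$. *)

(* Defs.v *)
From mathcomp Require Import all_boot all_order all_algebra.
From mathcomp Require Import all_classical all_reals all_analysis.
Set Implicit Arguments. Unset Strict Implicit. Unset Printing Implicit Defensive.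
Import Order.TTheory GRing.Theory Num.Theory.
Local Open Scope ring_scope.

Notation cube m n := {ffun 'I_n -> 'I_m}.

Definition agree (m n : nat) (x y : cube m n) : nat := #|[set i | x i == y i]|.

(* F is (t-1)-avoiding: no x, y in F agree in exactly t-1 coordinates.
   Written as (agree x y).+1 <> t so that t = 0 ("(-1)-avoiding") is vacuous. *)
Definition avoiding_pred (m n t : nat) (F : {set cube m n}) : Prop :=
  forall x y, x \in F -> y \in F -> (agree x y).+1 <> t.

Definition subcube (m n : nat) (Rs : {set 'I_n}) (alpha : cube m n) : {set cube m n} :=
  [set x : cube m n | [forall i in Rs, x i == alpha i]].

Definition mu (R : realType) (m n : nat) (F : {set cube m n}) : R :=
  (#|F|%:R) / ((m ^ n)%N)%:R.

(* Main.v *)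
Require Import Defs.
From mathcomp Require Import all_boot all_order all_algebra.
From mathcomp Require Import all_classical all_reals all_analysis.
From mathcomp Require Import zify ring lra fintype finset.
Set Implicit Arguments. Unset Strict Implicit. Unset Printing Implicit Defensive.
Import Order.TTheory GRing.Theory Num.Theory.
Local Open Scope ring_scope.

(* Points of [m]^n are identified with their graphs, sets of n literals (i, a), so that subcubes
   are given by sets of literals P. If F is dense on a subcube even after deleting a few literals,
   then by maximizing |link P| (m/h)^|P|, for a small power h of m, one finds inside it a piece
   that is spread: fixing k more literals divides its measure by at least (m/h)^k. Two spread
   pieces whose fixed literals agree fewer than t times, and which share a further block of
   coordinates, would contain two points agreeing exactly t-1 times. Hence the projections of
   such pieces to a block of coordinates are disjoint, and over about n/t disjoint blocks this
   bounds a family of pieces of measures d_j as in: d_j <= 2 a_j^(n/t - O(1)) with the a_j summing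
   to at most 3/2. Applied to many copies of one subcube of codimension less than t, it shows that
   F is captured there by few literals, up to a negligible error; so F is essentially covered by
   few subcubes of codimension t. Applied to those of them on which F is not too thin, it shows
   that all but one contribute exponentially little. *)

(** * Literals, links and independence of coordinates *)

Definition lits (m n : nat) (x : cube m n) : {set 'I_n * 'I_m} :=
  [set v | x v.1 == v.2].

(** The points stay in the full cube, so for consistent P the density of F inside the subcube of P
    is [mu R (link F P) * m%:R ^+ #|P|]. *)
Definition link (m n : nat) (F : {set cube m n}) (P : {set 'I_n * 'I_m}) : {set cube m n} :=
  [set x in F | P \subset lits x].

Definition dom (m n : nat) (P : {set 'I_n * 'I_m}) : {set 'I_n} := [set v.1 | v in P].

Lemma linkP (m n : nat) (F : {set cube m n}) (P : {set 'I_n * 'I_m}) (x : cube m n) :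
  reflect (x \in F /\ P \subset lits x) (x \in link F P).
Proof. by rewrite inE; apply: andP. Qed.

Lemma litsP (m n : nat) (P : {set 'I_n * 'I_m}) (x : cube m n) :
  reflect (forall v, v \in P -> x v.1 = v.2) (P \subset lits x).
Proof.
apply: (iffP subsetP) => h v vP; first by have := h v vP; rewrite inE => /eqP.
by rewrite inE; apply/eqP/h.
Qed.

Lemma agree_lits (m n : nat) (x y : cube m n) : agree x y = #|lits x :&: lits y|.
Proof.
rewrite /agree -(card_imset _ (f := fun i => (i, x i))); last by move=> i j [].
apply: eq_card => -[i a]; rewrite !inE /=; apply/imsetP/andP.
  by case=> j; rewrite inE => /eqP e [-> ->]; rewrite e eqxx.
by case=> /eqP e1 /eqP e2; exists i; rewrite ?inE e1 ?e2.
Qed.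

Lemma card_lits (m n : nat) (x : cube m n) : #|lits x| = n.
Proof.
have -> : lits x = [set (i, x i) | i in 'I_n].
  apply/setP => -[i a]; rewrite inE /=; apply/eqP/imsetP; first by move=> <-; exists i.
  by case=> j _ [-> ->].
by rewrite card_imset ?card_ord // => i j [].
Qed.

Lemma card_dom (m n : nat) (P : {set 'I_n * 'I_m}) (x : cube m n) :
  P \subset lits x -> #|dom P| = #|P|.
Proof.
move=> /litsP h; apply: card_in_imset => -[i a] [j b] /h /= ea /h /= eb e.
by rewrite -ea -eb -e.
Qed.

Lemma card_cube (m n : nat) : #|[set: cube m n]| = (m ^ n)%N.
Proof. by rewrite cardsT card_ffun !card_ord. Qed.

(** A nonempty link makes P part of the graph of a point, so P fixes [#|P|] distinct coordinates; a
    contradictory P has an empty link. *)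
Lemma card_link_le (m n : nat) (F : {set cube m n}) (P : {set 'I_n * 'I_m}) :
  (#|link F P| * m ^ #|P| <= m ^ n)%N.
Proof.
have [->|[x0 /linkP[_ Px0]]] := set_0Vmem (link F P); first by rewrite cards0.
pose G i := if i \in dom P then pred1 (x0 i) else predT.
have sub : link F P \subset family G.
  apply/subsetP => x /linkP[_ /litsP h]; apply/familyP => i; rewrite /G.
  case: ifP => // /imsetP[v vP ->].
  by rewrite inE h // (litsP _ _ Px0).
have cG : #|family G| = (m ^ (n - #|P|))%N.
  rewrite card_family foldrE big_map enumT -/(index_enum _).
  rewrite (bigID (mem (dom P))) /= big1 ?mul1n; last by move=> i /[dup] h _; rewrite /G h card1.
  under eq_bigr => i /negbTE h do rewrite /G h card_ord.
  rewrite prod_nat_const; congr (_ ^ _)%N; rewrite -(card_dom Px0).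
  apply: (@addnI #|dom P|); rewrite subnKC; last first.
    by have := max_card (mem (dom P)); rewrite card_ord.
  by have := cardC (mem (dom P)); rewrite card_ord.
have Pn : (#|P| <= n)%N by have := subset_leq_card Px0; rewrite card_lits.
apply: leq_trans (leq_mul (subset_leq_card sub) (leqnn _)) _.
by rewrite cG -expnD subnK.
Qed.

Definition depends_on (m n : nat) (U : {set 'I_n}) (X : {set cube m n}) : Prop :=
  forall x y : cube m n, (forall i, i \in U -> x i = y i) -> x \in X -> y \in X.

Lemma depends_onW (m n : nat) (U W : {set 'I_n}) (X : {set cube m n}) :
  U \subset W -> depends_on U X -> depends_on W X.
Proof. by move=> /subsetP sUW dX x y e; apply: dX => i /sUW; apply: e. Qed.

Lemma depends_onI (m n : nat) (U : {set 'I_n}) (X Y : {set cube m n}) :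
  depends_on U X -> depends_on U Y -> depends_on U (X :&: Y).
Proof. by move=> dX dY x y e /setIP[xX xY]; apply/setIP; split; [apply: dX xX|apply: dY xY]. Qed.

(* Exchanging the coordinates in U of a pair of points is an involution. *)
Lemma card_indep (m n : nat) (U : {set 'I_n}) (X Y : {set cube m n}) :
  depends_on U X -> depends_on (~: U) Y ->
  (#|X :&: Y| * m ^ n <= #|X| * #|Y|)%N.
Proof.
move=> dX dY; rewrite -card_cube -!cardsX.
pose mix (x y : cube m n) : cube m n := [ffun i => if i \in U then x i else y i].
pose sw (p : cube m n * cube m n) := (mix p.1 p.2, mix p.2 p.1).
have swK : involutive sw.
  by case=> x y; rewrite /sw /=; congr pair; apply/ffunP => i; rewrite !ffunE; case: (i \in U).
(* For x in both X and Y, the swap of (x, y) has a first component agreeing with x on U and a second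
   one agreeing with x off U. *)
rewrite -(card_imset _ (inv_inj swK)); apply/subset_leq_card/subsetP => _ /imsetP[[x y] + ->].
rewrite !inE /= => /andP[/andP[xX xY] _]; apply/andP; split=> /=.
  by apply: dX xX => i iU; rewrite ffunE iU.
by apply: dY xY => i; rewrite inE => /negbTE iU; rewrite ffunE iU.
Qed.

Lemma mu_ge0 (R : realType) (m n : nat) (X : {set cube m n}) : 0 <= mu R X.
Proof. by rewrite /mu divr_ge0. Qed.

Lemma mu_indep (R : realType) (m n : nat) (U : {set 'I_n}) (X Y : {set cube m n}) :
  depends_on U X -> depends_on (~: U) Y -> mu R (X :&: Y) <= mu R X * mu R Y.
Proof.
move=> dX dY; have := card_indep dX dY; rewrite /mu.
(* For an empty cube the inverse is 0 and both sides vanish. *)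
have [->|mn0] := posnP (m ^ n)%N; first by rewrite invr0 !mulr0.
rewrite -(ler_nat R) !natrM => h.
rewrite mulf_div ler_pdivrMr ?ltr0n // mulrAC -mulf_div divff ?mulr1; last first.
  by rewrite pnatr_eq0 -lt0n.
by rewrite ler_pdivlMr ?ltr0n.
Qed.

Lemma mu_le1 (R : realType) (m n : nat) (X : {set cube m n}) : mu R X <= 1.
Proof.
rewrite /mu; have [->|mn0] := posnP (m ^ n)%N; first by rewrite invr0 mulr0.
by rewrite ler_pdivrMr ?ltr0n // mul1r ler_nat -card_cube subset_leq_card ?subsetT.
Qed.

(** Each block is split off in turn by [mu_indep]: D and the remaining sets depend only on
    coordinates outside it. *)
Lemma mu_bigI (R : realType) (m n : nat) (U0 : {set 'I_n}) (D : {set cube m n})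
    (I : eqType) (s : seq I) (B : I -> {set 'I_n}) (X : I -> {set cube m n}) :
  uniq s -> depends_on U0 D -> (forall l, depends_on (B l) (X l)) ->
  {in s, forall l, [disjoint U0 & B l]} ->
  {in s &, forall l l', l != l' -> [disjoint B l & B l']} ->
  mu R (D :&: \bigcap_(l <- s) X l) <= mu R D * \prod_(l <- s) mu R (X l).
Proof.
move=> + dD dX.
elim: s => [_ _ _|l s IH /= /andP[ls us] dU dB].
  by rewrite !big_nil setIT mulr1.
have {}IH : mu R (D :&: \bigcap_(l <- s) X l) <= mu R D * \prod_(l <- s) mu R (X l).
  by apply: IH => // [k ks|k k' ks k's]; [apply: dU|apply: dB]; rewrite inE ?ks ?k's orbT.
rewrite !big_cons setICA mulrCA.
apply: le_trans (ler_wpM2l (mu_ge0 _ _) IH).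
apply: mu_indep (dX l) _; apply: depends_onI.
  by apply: depends_onW dD; rewrite -disjoints_subset dU ?mem_head.
rewrite big_seq; elim/big_ind: _ => [x y _|Y Z|k ks]; first by rewrite !inE.
  exact: depends_onI.
apply: depends_onW (dX k); rewrite -disjoints_subset dB ?inE ?eqxx ?ks ?orbT //.
by apply: contraNneq ls => <-.
Qed.

(** * Spread families *)

(* [lam] stands for m^(1-o(1)); the trivial bound for a set of full measure has [lam = m]. *)
Definition spread (R : realType) (m n : nat) (lam : R) (P : {set 'I_n * 'I_m})
    (A : {set cube m n}) : Prop :=
  (forall x, x \in A -> P \subset lits x) /\
  (forall Q : {set 'I_n * 'I_m}, [disjoint Q & P] ->
     #|link A Q|%:R * lam ^+ #|Q| <= #|A|%:R).

Lemma link_link (m n : nat) (F : {set cube m n}) (P Q : {set 'I_n * 'I_m}) :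
  link (link F P) Q = link F (P :|: Q).
Proof. by apply/setP => x; rewrite !inE subUset andbA. Qed.

(** For P maximizing |link G P| lam^|P| above P0, comparison with P :|: Q is spreadness and
    comparison with P0 is the last bound. *)
Lemma exists_spread (R : realType) (m n : nat) (lam : R) (P0 : {set 'I_n * 'I_m})
    (G : {set cube m n}) :
  0 < lam -> G != set0 -> (forall x, x \in G -> P0 \subset lits x) ->
  exists (P : {set 'I_n * 'I_m}) (A : {set cube m n}),
    [/\ P0 \subset P, A \subset G, A != set0, spread lam P A &
    #|G|%:R * lam ^+ #|P0| <= #|A|%:R * lam ^+ #|P| ].
Proof.
move=> lam0 G0 GP0.
pose f (P : {set 'I_n * 'I_m}) := #|link G P|%:R * lam ^+ #|P|.
have [P P0P maxP] := @arg_maxP _ R _ P0 (fun P => P0 \subset P) f (subxx P0).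
have lP0 : link G P0 = G.
  by apply/setP => x; rewrite inE; case: (boolP (x \in G)) => //= /GP0.
have le0 : #|G|%:R * lam ^+ #|P0| <= #|link G P|%:R * lam ^+ #|P|.
  by have := maxP P0 (subxx _); rewrite /f lP0.
exists P, (link G P); split=> //.
- by apply/subsetP => x /linkP[].
- apply: contraTneq le0 => ->; rewrite cards0 mul0r -ltNge mulr_gt0 ?exprn_gt0 //.
  by rewrite ltr0n card_gt0.
- split=> [x /linkP[]//|Q dQP]; rewrite link_link.
  have cPQ : #|P :|: Q| = (#|P| + #|Q|)%N.
    by rewrite cardsU disjoint_setI0 1?disjoint_sym // cards0 subn0.
  have : f (P :|: Q) <= f P by exact: maxP (subset_trans P0P (subsetUl _ _)).
  by rewrite /f cPQ exprD [_ ^+ #|P| * _]mulrC mulrA ler_pM2r ?exprn_gt0.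
Qed.

Lemma card_bigcup_le (I T : finType) (P : pred I) (F : I -> {set T}) :
  (#|\bigcup_(i | P i) F i| <= \sum_(i | P i) #|F i|)%N.
Proof.
elim/big_rec2: _ => [|i k X _ h]; first by rewrite cards0.
by apply: leq_trans (leq_card_setU _ _) _; rewrite leq_add2l.
Qed.

Lemma bin_le_exp (N k : nat) : ('C(N, k) <= N ^ k)%N.
Proof.
have fl : (N ^_ k <= N ^ k)%N.
  elim: k N => [|k IH] N //; rewrite ffactnS expnS leq_mul //.
  by apply: leq_trans (IH _) _; case: k {IH} => // k; rewrite leq_exp2r // leq_pred.
apply: leq_trans fl; rewrite -bin_ffact; apply: leq_pmulr; exact: fact_gt0.
Qed.

(** The core drops the points through a rare set T of fewer than t literals, one whose link has less
    than th times the share m^-|T| of A that uniformity would give. *)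
Definition core (R : realType) (m n : nat) (th : R) (t : nat) (A : {set cube m n}) :
    {set cube m n} :=
  [set x in A | [forall T : {set 'I_n * 'I_m}, (T \subset lits x) && (#|T| < t)%N ==>
     (th * #|A|%:R <= #|link A T|%:R * m%:R ^+ #|T|)]].

(** Union bound: there are at most n^t m^k sets of k literals, and each rare one removes less than
    th m^-k |A| points, so at most half of A is lost. *)
Lemma card_core (R : realType) (m n : nat) (th : R) (t : nat) (A : {set cube m n}) :
  (0 < m)%N -> (0 < n)%N -> 0 <= th -> th * (2 * t * n ^ t)%:R <= 1 ->
  #|A|%:R <= 2 * #|core th t A|%:R :> R.
Proof.
move=> m0 n0 th0 thP.
pose bad (T : {set 'I_n * 'I_m}) := (#|T| < t)%N && (#|link A T|%:R * m%:R ^+ #|T| < th * #|A|%:R).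
have sub : A :\: core th t A \subset \bigcup_(T | bad T) link A T.
  apply/subsetP => x; rewrite !inE => /andP[+ xA]; rewrite xA /=.
  rewrite negb_forall => /existsP[T]; rewrite negb_imply -ltNge => /andP[/andP[Tx Tt] h].
  by apply/bigcupP; exists T; rewrite /bad ?Tt // inE xA.
have mR : 0 < m%:R :> R by rewrite ltr0n.
have bd : #|A :\: core th t A|%:R <= th * (t * n ^ t)%:R * #|A|%:R :> R.
  apply: le_trans (_ : (\sum_(T | bad T) #|link A T|)%:R <= _).
    by rewrite ler_nat; apply: leq_trans (subset_leq_card sub) (card_bigcup_le _ _).
  rewrite natr_sum.
  apply: le_trans (_ : \sum_(T : {set 'I_n * 'I_m} | (#|T| < t)%N) th * #|A|%:R / m%:R ^+ #|T| <= _).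
    rewrite (big_mkcond bad) [leRHS]big_mkcond; apply: ler_sum => T _; rewrite /bad.
    case: ltnP => //= _; case: ifP => [/ltW h|_].
      by rewrite ler_pdivlMr ?exprn_gt0.
    by rewrite divr_ge0 ?mulr_ge0 ?exprn_ge0 // ltW.
  (* Group the sets by size; [inord] needs a successor type, so the extra index t is filtered
     out. *)
  rewrite (partition_big (fun T : {set 'I_n * 'I_m} => inord #|T| : 'I_t.+1) (fun k => (k < t)%N)) /=; last first.
    by move=> T Tt; rewrite inordK // ltnW.
  apply: le_trans (_ : \sum_(k < t.+1 | (k < t)%N) th * (n ^ t)%:R * #|A|%:R <= _).
    apply: ler_sum => k kt.
    apply: le_trans (_ : \sum_(T in [set T : {set 'I_n * 'I_m} | #|T| == k]) th * #|A|%:R / m%:R ^+ k <= _).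
      rewrite big_mkcond [leRHS]big_mkcond; apply: ler_sum => T _; rewrite inE.
      case: (ltnP #|T| t) => /= Tt.
        rewrite -val_eqE /= inordK 1?ltnW //; case: eqP => [->|] //.
      by case: ifP => // _; rewrite divr_ge0 ?mulr_ge0 ?exprn_ge0 // ltW.
    rewrite sumr_const card_draws card_prod !card_ord -[leLHS]mulr_natr.
    have hb : 'C(n * m, k)%:R <= (n ^ t)%:R * m%:R ^+ k :> R.
      rewrite -natrX -natrM ler_nat; apply: leq_trans (bin_le_exp _ _) _.
      by rewrite expnMn leq_mul2r leq_pexp2l ?orbT // ltnW.
    apply: le_trans (ler_wpM2l _ hb) _; first by rewrite divr_ge0 ?mulr_ge0 ?exprn_ge0 // ltW.
    have mk0 : m%:R ^+ k != 0 :> R by rewrite lt0r_neq0 ?exprn_gt0.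
    move: (m%:R ^+ k) mk0 (#|A|%:R : R) ((n ^ t)%:R : R) => u u0 a p.
    by rewrite le_eqVlt; apply/orP; left; apply/eqP; field.
  rewrite sumr_const -[leLHS]mulr_natl natrM.
  have ct : #|[pred k : 'I_t.+1 | (k < t)%N]| = t.
    have -> : #|[pred k : 'I_t.+1 | (k < t)%N]| = #|[set~ (ord_max : 'I_t.+1)]|.
      by apply: eq_card => k; rewrite !inE -val_eqE /= ltn_neqAle -ltnS ltn_ord andbT.
    by rewrite cardsC1 card_ord.
  by rewrite ct; lra.
have : #|A|%:R = #|core th t A|%:R + #|A :\: core th t A|%:R :> R.
  rewrite -natrD -(cardsID (core th t A) A) (setIidPr _) //.
  by apply/subsetP => x; rewrite inE => /andP[].
have : th * (t * n ^ t)%:R * 2 * #|A|%:R <= 1 * #|A|%:R.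
  by rewrite ler_wpM2r //; move: thP; rewrite -mulnA natrM; lra.
lra.
Qed.

(* A point of A1 through T avoiding P2 :\: P1, then a point of A2 through T avoiding it
   outside P2 and T, agree exactly on (P1 :&: P2) :|: T. *)
Lemma spread_agree (R : realType) (m n t : nat) (F : {set cube m n}) (lam th : R)
    (P1 P2 T : {set 'I_n * 'I_m}) (A1 A2 : {set cube m n}) :
  avoiding_pred t F -> A1 \subset F -> A2 \subset F -> A1 != set0 -> A2 != set0 ->
  (0 < m)%N -> 0 < lam ->
  spread lam P1 A1 -> spread lam P2 A2 -> [disjoint T & P1] -> [disjoint T & P2] ->
  (#|P2| <= n)%N -> n%:R * m%:R ^+ #|T| < th * lam ^+ #|T|.+1 ->
  th * #|A1|%:R <= #|link A1 T|%:R * m%:R ^+ #|T| ->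
  th * #|A2|%:R <= #|link A2 T|%:R * m%:R ^+ #|T| ->
  (#|P1 :&: P2| + #|T|).+1 = t -> False.
Proof.
move=> av A1F A2F A10 A20 m0 lam0 s1 s2 dT1 dT2 P2n num.
have mR : 0 < m%:R :> R by rewrite ltr0n.
(* If every point of [link A T] met W, the links of v |: T for v in W would cover it; spreadness
   bounds their total by n |A| / lam^(|T|+1), which is below th |A| m^-|T|. *)
have find (P W : {set 'I_n * 'I_m}) (A : {set cube m n}) :
    A != set0 -> spread lam P A -> [disjoint T & P] -> (#|W| <= n)%N ->
    [disjoint W & P :|: T] -> th * #|A|%:R <= #|link A T|%:R * m%:R ^+ #|T| ->
    exists2 x, x \in link A T & [disjoint W & lits x].
  move=> A0 [_ sA] dTP Wn dW h.
  have [/subsetP sub|/subsetPn[x xA nx]] := boolP (link A T \subset \bigcup_(v in W) link A (v |: T)); last first.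
    exists x => //; rewrite disjoints_subset; apply/subsetP => v vW; rewrite inE.
    apply: contra nx => vx; apply/bigcupP; exists v => //; apply/linkP.
    by move/linkP: xA => [-> Tx]; rewrite subUset sub1set vx.
  exfalso; suff : #|link A T|%:R * m%:R ^+ #|T| * lam ^+ #|T|.+1 < th * #|A|%:R * lam ^+ #|T|.+1.
    by rewrite ltr_pM2r ?exprn_gt0 // ltNge h.
  rewrite mulrAC; apply: (@le_lt_trans _ _ (n%:R * #|A|%:R * m%:R ^+ #|T|)); last first.
    by rewrite mulrAC [ltRHS]mulrAC ltr_pM2r ?ltr0n ?card_gt0.
  rewrite ler_pM2r ?exprn_gt0 //.
  apply: le_trans (_ : (\sum_(v in W) #|link A (v |: T)|)%:R * lam ^+ #|T|.+1 <= _).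
    rewrite ler_pM2r ?exprn_gt0 // ler_nat; apply: leq_trans (card_bigcup_le _ _).
    by apply/subset_leq_card/subsetP.
  rewrite natr_sum mulr_suml.
  apply: le_trans (_ : \sum_(v in W) #|A|%:R <= _); last first.
    by rewrite sumr_const -[leLHS]mulr_natl ler_wpM2r // ler_nat.
  apply: ler_sum => v vW.
  have vPT : v \notin P :|: T by rewrite (disjointFr dW vW).
  have cT : #|v |: T| = #|T|.+1 by rewrite cardsU1; move: vPT; rewrite inE negb_or => /andP[_ ->].
  rewrite -cT; apply: sA; rewrite disjoints_subset subUset sub1set inE -disjoints_subset dTP andbT.
  by move: vPT; rewrite inE negb_or => /andP[].
move=> h1 h2 et.
have W1n : (#|P2 :\: P1| <= n)%N by apply: leq_trans (subset_leq_card (subsetDl _ _)) P2n.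
have W1d : [disjoint P2 :\: P1 & P1 :|: T].
  rewrite disjoints_subset; apply/subsetP => v; rewrite !inE => /andP[/negbTE -> vP2] /=.
  by rewrite (disjointFl dT2).
have [x xA1 dx] := find P1 _ A1 A10 s1 dT1 W1n W1d h1.
have W2n : (#|lits x :\: (P2 :|: T)| <= n)%N.
  by rewrite -[leqRHS](card_lits x) subset_leq_card ?subsetDl.
have W2d : [disjoint lits x :\: (P2 :|: T) & P2 :|: T].
  by rewrite disjoints_subset; apply/subsetP => v; rewrite !inE => /andP[].
have [y yA2 dy] := find P2 _ A2 A20 s2 dT2 W2n W2d h2.
move/linkP: xA1 => [xA1 Tx]; move/linkP: yA2 => [yA2 Ty].
have P1x := s1.1 _ xA1; have P2y := s2.1 _ yA2.
apply: (av x y (subsetP A1F _ xA1) (subsetP A2F _ yA2)); rewrite agree_lits -et; congr S.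
have -> : lits x :&: lits y = (P1 :&: P2) :|: T.
  apply/setP => v; apply/setIP/idP => [[vx vy]|].
    have := disjointFl dy vy; rewrite inE vx andbT => /negbFE.
    rewrite !inE => /orP[vP2|->]; last by rewrite orbT.
    have := disjointFl dx vx; rewrite inE vP2 andbT => /negbFE ->.
    by [].
  rewrite !inE => /orP[/andP[v1 v2]|vT].
    by move: (subsetP P1x _ v1) (subsetP P2y _ v2); rewrite !inE.
  by move: (subsetP Tx _ vT) (subsetP Ty _ vT); rewrite !inE.
have /disjoint_setI0 e : [disjoint P1 :&: P2 & T].
  by rewrite disjoint_sym; apply: disjointWr dT1; exact: subsetIl.
by rewrite cardsU e cards0 subn0.
Qed.

(** * Projections to blocks of coordinates *)

Lemma sum_card_disjoint (I T : finType) (Q : pred I) (X : I -> {set T}) :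
  {in Q &, forall i j, i != j -> [disjoint X i & X j]} ->
  (\sum_(i | Q i) #|X i| <= #|T|)%N.
Proof.
move=> dX; under eq_bigr => i _ do rewrite -sum1_card.
rewrite (exchange_big_dep predT) //= -sum1_card; apply: leq_sum => x _.
rewrite sum1_card; apply/card_le1_eqP => i j /andP[Qi xi] /andP[Qj xj].
by apply/eqP; apply: contraTT xj => ji; rewrite (disjointFl (dX _ _ Qj Qi ji)).
Qed.

(** The projection of X to the coordinates in U, kept as a cylinder in the full cube so that
    projections to different blocks are compared by one measure. *)
Definition cyl (m n : nat) (U : {set 'I_n}) (X : {set cube m n}) : {set cube m n} :=
  [set x : cube m n | [exists y : cube m n, (y \in X) && [forall i in U, x i == y i]]].

Lemma cylP (m n : nat) (U : {set 'I_n}) (X : {set cube m n}) (x : cube m n) :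
  reflect (exists2 y, y \in X & forall i, i \in U -> x i = y i) (x \in cyl U X).
Proof.
rewrite inE; apply: (iffP existsP) => [[y /andP[yX /forall_inP h]]|[y yX h]].
  by exists y => // i /h /eqP.
by exists y; rewrite yX; apply/forall_inP => i /h ->.
Qed.

Lemma depends_on_cyl (m n : nat) (U : {set 'I_n}) (X : {set cube m n}) :
  depends_on U (cyl U X).
Proof.
move=> x y e /cylP[z zX h]; apply/cylP; exists z => // i iU.
by rewrite -e // h.
Qed.

Lemma depends_on_link_setT (m n : nat) (P : {set 'I_n * 'I_m}) :
  depends_on (dom P) (link [set: cube m n] P).
Proof.
move=> x y e /linkP[_ /litsP h]; apply/linkP; split; first by rewrite inE.
by apply/litsP => v vP; rewrite -e ?h //; apply/imsetP; exists v.
Qed.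

Lemma mu_link_le (R : realType) (m n : nat) (F : {set cube m n}) (P : {set 'I_n * 'I_m}) :
  mu R (link F P) * m%:R ^+ #|P| <= 1.
Proof.
rewrite /mu; have [->|mn0] := posnP (m ^ n)%N; first by rewrite invr0 mulr0 mul0r.
by rewrite mulrAC ler_pdivrMr ?ltr0n // mul1r -natrX -natrM ler_nat card_link_le.
Qed.

Lemma mu_subset (R : realType) (m n : nat) (X Y : {set cube m n}) :
  X \subset Y -> mu R X <= mu R Y.
Proof. by move=> sXY; rewrite /mu ler_wpM2r ?invr_ge0 // ler_nat subset_leq_card. Qed.

(** Blocks meeting D pick distinct elements of D, being disjoint, so at most [#|D|] of them meet
    it. *)
Lemma card_disjoint_blocks (n b : nat) (B : nat -> {set 'I_n}) (D : {set 'I_n}) :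
  (forall l l', (l < b)%N -> (l' < b)%N -> l != l' -> [disjoint B l & B l']) ->
  (b - #|D| <= #|[pred l : 'I_b | [disjoint D & B l]]|)%N.
Proof.
move=> dB.
have e := cardC [pred l : 'I_b | [disjoint D & B l]]; rewrite card_ord in e.
rewrite leq_subLR addnC; apply: leq_trans (eq_leq (esym e)) _; rewrite leq_add2l.
pose f (l : 'I_b) : option 'I_n := [pick i in D :&: B l].
have fP (l : 'I_b) : ~~ [disjoint D & B l] -> exists2 i, f l = Some i & i \in D :&: B l.
  rewrite -setI_eq0 /f => /set0Pn[i0 i0D]; case: pickP => [i h|/(_ i0)]; first by exists i.
  by rewrite i0D.
rewrite -(card_in_imset (f := f)); last first.
  move=> l l'; rewrite !inE => /fP[i ei /setIP[_ il]] /fP[i' ei' /setIP[_ il']].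
  rewrite ei ei' => -[ii']; apply/eqP; apply: contraTT il => ll'; rewrite ii'.
  by rewrite (disjointFl (dB _ _ (ltn_ord l) (ltn_ord l') ll')).
rewrite -(card_imset (mem D) Some_inj); apply/subset_leq_card/subsetP => _ /imsetP[l + ->].
by rewrite inE => /fP[i -> /setIP[iD _]]; apply: imset_f.
Qed.

(* [p j l] is the measure of the projection of the core of [A j] on the block [B l]. For a
   fixed block these projections are disjoint (a common point would give two points with
   exactly t-1 agreements), while by independence of the blocks and the AM-GM inequality
   [A j] is no larger than the corresponding power of the average of the [p j l]. *)
Lemma spread_weights (R : realType) (m n t b c L : nat) (F : {set cube m n}) (lam th : R)
    (B : nat -> {set 'I_n}) (P : 'I_L -> {set 'I_n * 'I_m}) (A : 'I_L -> {set cube m n}) :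
  avoiding_pred t F -> (0 < m)%N -> (0 < n)%N -> 0 < lam -> 0 <= th ->
  th * (2 * t * n ^ t)%:R <= 1 ->
  (forall k, (k < t)%N -> n%:R * m%:R ^+ k < th * lam ^+ k.+1) ->
  (forall l, (l < b)%N -> (t <= #|B l|.+1)%N) ->
  (forall l l', (l < b)%N -> (l' < b)%N -> l != l' -> [disjoint B l & B l']) ->
  (c < b)%N -> (c <= n)%N ->
  (forall j, [/\ A j \subset F, A j != set0, spread lam (P j) (A j) & (#|P j| <= c)%N]) ->
  (forall i j, i != j -> (#|P i :&: P j| < t)%N) ->
  exists a : 'I_L -> R, [/\ forall j, 0 <= a j,
    forall j, mu R (A j) * m%:R ^+ #|P j| <= 2 * a j ^+ (b - c) &
    (b - c)%:R * (\sum_j a j) <= b%:R].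
Proof.
move=> av m0 n0 lam0 th0 thP num Bt dB cb cn HA HP.
pose G (j : 'I_L) := [pred l : 'I_b | [disjoint dom (P j) & B l]].
pose C j := core th t (A j).
pose p (j : 'I_L) (l : 'I_b) := mu R (cyl (B l) (C j)).
pose a j := (\sum_(l in G j) p j l) / #|G j|%:R.
have Gb j : (b - c <= #|G j|)%N.
  have [_ _ _ Pc] := HA j.
  apply: leq_trans (card_disjoint_blocks _ dB); apply: leq_sub2l.
  exact: leq_trans (leq_imset_card _ _) Pc.
have G0 j : 0 < #|G j|%:R :> R by rewrite ltr0n; apply: leq_trans (Gb j); rewrite subn_gt0.
have p0 j l : 0 <= p j l by exact: mu_ge0.
have s0 j : 0 <= \sum_(l in G j) p j l by exact: sumr_ge0.
have a0 j : 0 <= a j by rewrite divr_ge0 // ltW.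
have a1 j : a j <= 1.
  rewrite ler_pdivrMr // mul1r -[leRHS]mulr1 mulr_natl -sumr_const; apply: ler_sum => l _.
  exact: mu_le1.
have mR : 0 < m%:R :> R by rewrite ltr0n.
exists a; split=> // [j|].
  have [AF A0 sA _] := HA j.
  have cC : mu R (A j) <= 2 * mu R (C j).
    rewrite /mu mulrA ler_wpM2r ?invr_ge0 //; exact: card_core.
  have CA : C j \subset A j by apply/subsetP => x; rewrite inE => /andP[].
  (* The domain of [P j] and the blocks in [G j] are pairwise disjoint, so the measures multiply;
     the factor of the subcube cancels m^|P j|. *)
  have Csub : C j \subset link [set: cube m n] (P j) :&: \bigcap_(l <- enum (G j)) cyl (B l) (C j).
    apply/subsetP => x xC; rewrite inE; apply/andP; split.
      by apply/linkP; split; rewrite ?inE //; apply: sA.1; apply: (subsetP CA).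
    rewrite big_seq; elim/big_ind: _ => [|X Y xX xY|l _]; first by rewrite inE.
      by rewrite inE xX xY.
    by apply/cylP; exists x.
  have mC : mu R (C j) <= mu R (link [set: cube m n] (P j)) * \prod_(l in G j) p j l.
    apply: le_trans (mu_subset R Csub) _; rewrite -big_enum.
    apply: (mu_bigI R (U0 := dom (P j)) (B := fun l : 'I_b => B l)).
    - exact: enum_uniq.
    - exact: depends_on_link_setT.
    - by move=> l; exact: depends_on_cyl.
    - by move=> l; rewrite mem_enum.
    - by move=> l l' _ _ ll'; apply: dB.
  have AGM : \prod_(l in G j) p j l <= a j ^+ #|G j|.
    have := leif_AGM (A := G j) (E := p j) (fun l _ => p0 j l).
    by case.
  (* Since [a j] is at most 1, lowering the exponent from [#|G j|] to b - c only weakens the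
     bound. *)
  have le1 : \prod_(l in G j) p j l <= a j ^+ (b - c).
    by apply: le_trans AGM _; apply: ler_wiXn2l.
  have pr0 : 0 <= \prod_(l in G j) p j l by exact: prodr_ge0.
  have := mu_link_le R [set: cube m n] (P j).
  have := mu_ge0 R (link [set: cube m n] (P j)).
  move: mC cC le1 pr0; set M := m%:R ^+ _; have : 0 < M by rewrite exprn_gt0.
  move: (mu R (A j)) (mu R (C j)) (mu R (link _ _)) (\prod_(l in _) _) (_ ^+ (b - c)).
  move=> uA uC uD q r M0 h1 h2 h3 q0 D0 h4.
  apply: le_trans (_ : 2 * (uD * q) * M <= _); first rewrite ler_pM2r //.
    by apply: le_trans h2 _; rewrite ler_pM2l ?ltr0n.
  rewrite -mulrA ler_pM2l ?ltr0n // [uD * q]mulrC -mulrA.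
  by apply: le_trans h3; rewrite -[leRHS]mulr1 ler_wpM2l.
(* A common point z of two projections would supply literals T on the block, present in a core point
   of each piece, against [spread_agree]. *)
have dis (l : 'I_b) : \sum_(j | l \in G j) p j l <= 1.
  rewrite /p /mu -mulr_suml -natr_sum ler_pdivrMr ?ltr0n ?expn_gt0 ?m0 // mul1r ler_nat.
  rewrite -card_cube cardsT; apply: sum_card_disjoint => i j li lj ij.
  rewrite disjoints_subset; apply/subsetP => z /cylP[x xC ex]; rewrite inE.
  apply/negP => /cylP[y yC ey].
  have [Ai Ai0 si ci] := HA i; have [Aj Aj0 sj cj] := HA j.
  (* The number of agreements to add to the common literals to reach exactly t - 1. *)
  pose k := (t.-1 - #|P i :&: P j|)%N.
  have [kt ek] : (k < t)%N /\ (#|P i :&: P j| + k).+1 = t.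
    by have := HP _ _ ij; rewrite /k; move: #|_| => s; clear; lia.
  have [T0 T0B cT0] : exists2 T0 : {set 'I_n}, T0 \subset B l & #|T0| = k.
    have kB : (k <= #|B l|)%N by apply: leq_trans (leq_subr _ _) _; have := Bt l (ltn_ord l); case: (t).
    have [T0 /andP[h /eqP <-]] : exists T0 : {set 'I_n}, (T0 \subset B l) && (#|T0| == k).
      have : (0 < #|[set T0 : {set 'I_n} | (T0 \subset B l) && (#|T0| == k)]|)%N.
        by rewrite cards_draws bin_gt0.
      by rewrite card_gt0 => /set0Pn[T0]; rewrite inE; exists T0.
    by exists T0.
  pose T := [set (i, z i) | i in T0].
  have cT : #|T| = k by rewrite card_imset // => u v [].
  have Tx : T \subset lits x.
    by apply/litsP => _ /imsetP[u uT ->] /=; rewrite -ex // (subsetP T0B).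
  have Ty : T \subset lits y.
    by apply/litsP => _ /imsetP[u uT ->] /=; rewrite -ey // (subsetP T0B).
  have dT j' : l \in G j' -> [disjoint T & P j'].
    rewrite inE => h; rewrite disjoints_subset; apply/subsetP => _ /imsetP[u uT ->].
    rewrite inE; apply/negP => uP; have := disjointFl h (subsetP T0B _ uT).
    by move/negP; apply; apply/imsetP; exists (u, z u).
  have hc j' w : w \in C j' -> T \subset lits w ->
      th * #|A j'|%:R <= #|link (A j') T|%:R * m%:R ^+ #|T|.
    by rewrite inE => /andP[_ /forallP /(_ T)] + h; rewrite h cT kt.
  apply: (spread_agree av Ai Aj Ai0 Aj0 m0 lam0 si sj (dT _ li) (dT _ lj) _ _ (hc _ _ xC Tx) (hc _ _ yC Ty)).
  - exact: leq_trans cj cn.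
  - by rewrite cT; apply: num.
  - by rewrite cT ek.
(* (b - c) a_j is at most the sum of the p j l over l in [G j]; after exchanging the sums each of
   the b blocks contributes at most 1. *)
apply: le_trans (_ : \sum_j \sum_(l in G j) p j l <= _).
  rewrite mulr_sumr; apply: ler_sum => j _; rewrite /a mulrA.
  by rewrite ler_pdivrMr // mulrC ler_wpM2l // ler_nat.
rewrite (exchange_big_dep predT) //=.
apply: le_trans (ler_sum _ (fun l _ => dis l)) _.
by rewrite sumr_const card_ord.
Qed.

(** * Capturing and covering *)

(* [h] is a small power of [m] absorbing all polynomial factors in [n], [C] bounds the number of
   literals added when passing to a spread piece, and [B] lists [b] blocks of coordinates. *)
Record regime (R : realType) (m n t b C : nat) (h th : R) (B : nat -> {set 'I_n}) : Prop :=
  Regime {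
    reg_m : (0 < m)%N;
    reg_n : (0 < n)%N;
    reg_h : 2 < h;
    reg_th : 0 <= th;
    reg_thn : th * (2 * t * n ^ t)%:R <= 1;
    reg_num : forall k, (k < t)%N -> n%:R * m%:R ^+ k < th * (m%:R / h) ^+ k.+1;
    reg_block : forall l, (l < b)%N -> (t <= #|B l|.+1)%N;
    reg_disj : forall l l', (l < b)%N -> (l' < b)%N -> l != l' -> [disjoint B l & B l'];
    reg_b : (3 * (t + C) < b)%N;
    reg_bn : (t + C <= n)%N
  }.

Definition off (m n : nat) (F : {set cube m n}) (P J : {set 'I_n * 'I_m}) : {set cube m n} :=
  [set x in link F P | [disjoint J & lits x]].

(* The pieces are chosen one after the other, each avoiding the literals of the other nodes and of
   the earlier pieces, so that two pieces share no more literals than the nodes they come from. *)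
Lemma select_spread (R : realType) (m n t b C L Q : nat) (F : {set cube m n}) (h th : R)
    (B : nat -> {set 'I_n}) (P0 : 'I_L -> {set 'I_n * 'I_m}) (rho : 'I_L -> R) :
  regime m t b C h th B -> (L * (2 * t + C) <= Q)%N ->
  (forall j, (#|P0 j| <= t)%N) ->
  (forall j, h ^- C <= rho j) ->
  (forall j (J : {set 'I_n * 'I_m}), (#|J| <= Q)%N -> [disjoint J & P0 j] ->
     rho j <= mu R (off F (P0 j) J) * m%:R ^+ #|P0 j|) ->
  forall l, (l <= L)%N ->
  exists (P : 'I_L -> {set 'I_n * 'I_m}) (A : 'I_L -> {set cube m n}),
    forall j : 'I_L, (j < l)%N ->
      [/\ [/\ A j \subset F, A j != set0, spread (m%:R / h) (P j) (A j) & (#|P j| <= t + C)%N],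
          rho j <= mu R (A j) * m%:R ^+ #|P j|,
          forall i, [disjoint P j & P0 i :\: P0 j] &
          forall i : 'I_L, (i < j)%N -> P i :&: P j \subset P0 j].
Proof.
move=> reg LQ P0t hrho robust.
have h0 : 0 < h by apply: lt_trans (reg_h reg).
have h1 : 1 < h by apply: lt_trans (reg_h reg); rewrite ltr1n.
have mR : 0 < m%:R :> R by rewrite ltr0n (reg_m reg).
elim=> [_|l IH lL]; first by exists (fun _ => set0), (fun _ => set0).
have [P [A PA]] := IH (ltnW lL).
pose j := Ordinal lL.
(* At most L t literals come from the nodes and L (t + C) from the earlier pieces. *)
pose J := (\bigcup_i P0 i :|: \bigcup_(i : 'I_L | (i < l)%N) P i) :\: P0 j.
have dJ : [disjoint J & P0 j].
  by rewrite disjoints_subset; apply/subsetP => v; rewrite !inE => /andP[].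
have cJ : (#|J| <= Q)%N.
  apply: leq_trans LQ; apply: leq_trans (subset_leq_card (subsetDl _ _)) _.
  apply: leq_trans (leq_card_setU _ _) _.
  have -> : (L * (2 * t + C) = L * t + L * (t + C))%N by ring.
  apply: leq_add; apply: leq_trans (card_bigcup_le _ _) _.
    by rewrite -[X in (_ <= X * _)%N](card_ord L) -sum_nat_const; apply: leq_sum => i _.
  rewrite -[X in (_ <= X * _)%N](card_ord L) -sum_nat_const big_mkcond; apply: leq_sum => i _.
  by case: ifP => // il; have [[_ _ _]] := PA i il.
have rob := robust j J cJ dJ.
have rho0 : 0 < rho j by apply: lt_le_trans (hrho j); rewrite invr_gt0 exprn_gt0.
set G := off F (P0 j) J in rob.
have G0 : G != set0.
  by apply: contraTneq rob => ->; rewrite -ltNge /mu cards0 !mul0r.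
have GP0 x : x \in G -> P0 j \subset lits x by rewrite inE => /andP[/linkP[]].
have lam0 : 0 < m%:R / h by rewrite divr_gt0.
have [P' [A' [P0P' A'G A'0 sA' big]]] := exists_spread lam0 G0 GP0.
have dP'J : [disjoint P' & J].
  have /set0Pn[x xA'] := A'0; have := subsetP A'G _ xA'; rewrite inE => /andP[_ dx].
  rewrite disjoint_sym; apply: disjointWr dx; exact: sA'.1.
(* Each added literal multiplies the relative density by at least h; it starts at h^-C or more and
   ends at most 1, so at most C literals are added. *)
have big' : mu R G * m%:R ^+ #|P0 j| * h ^+ (#|P'| - #|P0 j|) <= mu R A' * m%:R ^+ #|P'|.
  have := subset_leq_card P0P'; set p0 := #|P0 j|; set p := #|P'|; move=> p0p.
  have hp : 0 < h ^+ p by rewrite exprn_gt0.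
  have e0 : m%:R ^+ p0 * h ^+ (p - p0) = (m%:R / h) ^+ p0 * h ^+ p.
    rewrite -{2}(subnKC p0p) exprD mulrA -exprMn divfK //; exact: lt0r_neq0.
  have e1 : m%:R ^+ p = (m%:R / h) ^+ p * h ^+ p by rewrite -exprMn divfK // lt0r_neq0.
  rewrite -mulrA e0 e1 !mulrA ler_pM2r // /mu -!(mulrAC _ _ (_^-1)).
  by rewrite ler_wpM2r ?invr_ge0.
have hd : 1 <= h ^+ (#|P'| - #|P0 j|) by apply: exprn_ege1; exact: ltW.
have rA' : rho j <= mu R A' * m%:R ^+ #|P'|.
  apply: le_trans rob (le_trans _ big'); apply: ler_peMr hd.
  by rewrite mulr_ge0 ?mu_ge0 // ltW // exprn_gt0.
have A'1 : mu R A' * m%:R ^+ #|P'| <= 1.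
  have -> : A' = link A' P'; last exact: mu_link_le.
  by apply/setP => x; rewrite inE; case: (boolP (x \in A')) => //= /sA'.1.
have cP' : (#|P'| <= t + C)%N.
  rewrite leqNgt; apply/negP => tC.
  have dC : (C < #|P'| - #|P0 j|)%N by move: (P0t j) tC; clear; move: #|P'| #|P0 j| => p q; lia.
  suff : 1 < mu R G * m%:R ^+ #|P0 j| * h ^+ (#|P'| - #|P0 j|).
    by rewrite ltNge (le_trans big' A'1).
  apply: lt_le_trans (_ : h ^- C * h ^+ (#|P'| - #|P0 j|) <= _).
    rewrite mulrC ltr_pdivlMr ?exprn_gt0 // mul1r ltr_eXn2l //.
  by rewrite ler_pM2r ?exprn_gt0 // (le_trans (hrho j)).
have A'F : A' \subset F.
  by apply: subset_trans A'G _; apply/subsetP => x; rewrite inE => /andP[/linkP[]].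
exists (fun i => if i == j then P' else P i), (fun i => if i == j then A' else A i) => i.
rewrite ltnS leq_eqVlt => /orP[/eqP il|il].
  have -> : i = j by exact: val_inj.
  rewrite eqxx; split=> //.
    move=> i'; rewrite disjoint_sym; apply: disjointWl (_ : _ \subset J) _; last by rewrite disjoint_sym.
    by apply: setSD; rewrite subsetU // (bigcup_sup i').
  move=> i' i'l; rewrite ifN; last by apply: contraTneq i'l => ->; rewrite ltnn.
  apply/subsetP => v /setIP[vi vP']; apply: contraTT vP' => nv; rewrite (disjointFl dP'J) //.
  by rewrite !inE nv /=; apply/orP; right; apply/bigcupP; exists i'.
have neq (i' : 'I_L) : (i' < l)%N -> (i' == j) = false.
  by move=> i'l; apply/eqP => e; move: i'l; rewrite e ltnn.
rewrite neq //; have [good r d q] := PA i il; split=> // i' i'i.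
by rewrite neq ?(ltn_trans i'i) // q.
Qed.

(** Literals common to two selected pieces lie in both nodes, so the pieces share fewer than t
    literals, as the nodes do, and [spread_weights] applies. *)
Lemma robust_weights (R : realType) (m n t b C L Q : nat) (F : {set cube m n}) (h th : R)
    (B : nat -> {set 'I_n}) (P0 : 'I_L -> {set 'I_n * 'I_m}) (rho : 'I_L -> R) :
  avoiding_pred t F -> regime m t b C h th B -> (L * (2 * t + C) <= Q)%N ->
  (forall j, (#|P0 j| <= t)%N) ->
  (forall i j, i != j -> (#|P0 i :&: P0 j| < t)%N) ->
  (forall j, h ^- C <= rho j) ->
  (forall j (J : {set 'I_n * 'I_m}), (#|J| <= Q)%N -> [disjoint J & P0 j] ->
     rho j <= mu R (off F (P0 j) J) * m%:R ^+ #|P0 j|) ->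
  exists a : 'I_L -> R, [/\ forall j, 0 <= a j,
    forall j, rho j <= 2 * a j ^+ (b - (t + C)) & \sum_j a j <= 3 / 2].
Proof.
move=> av reg LQ P0t P0d hrho robust.
have [P [A PA]] := select_spread reg LQ P0t hrho robust (leqnn L).
have HP (i j : 'I_L) : (i < j)%N -> (#|P i :&: P j| < t)%N.
  move=> ij; apply: leq_ltn_trans (P0d i j _); last by rewrite -val_eqE /= ltn_eqF.
  have [_ _ di _] := PA i (ltn_ord i); have [_ _ _ /(_ i ij) sj] := PA j (ltn_ord j).
  apply/subset_leq_card/subsetP => v vij; have vj := subsetP sj v vij.
  rewrite inE vj andbT; move: vij => /setIP[vi _].
  by have := disjointFr (di j) vi; rewrite inE vj andbT => /negbFE.
have h0 : 0 < h by apply: lt_trans (reg_h reg).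
have bc : (t + C < b)%N by have := reg_b reg; clear; lia.
have := spread_weights (lam := m%:R / h) (th := th) (B := B) (P := P) (A := A) av
  (reg_m reg) (reg_n reg) _ (reg_th reg) (reg_thn reg) (reg_num reg) (reg_block reg)
  (reg_disj reg) bc (reg_bn reg).
case.
- by rewrite divr_gt0 // ltr0n (reg_m reg).
- by move=> j; have [] := PA j (ltn_ord j).
- by move=> i j; rewrite neq_ltn => /orP[/HP//|/HP]; rewrite setIC.
move=> a [a0 ha sa]; exists a; split=> // [j|].
  by apply: le_trans (ha j); have [_] := PA j (ltn_ord j).
(* This is where 3/2 comes from: b > 3 (t + C). *)
have bR : b%:R <= (b - (t + C))%:R * (3 / 2) :> R.
  rewrite mulrA ler_pdivlMr // -!natrM ler_nat; have := reg_b reg; clear; lia.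
by rewrite -(ler_pM2l (x := (b - (t + C))%:R)) ?ltr0n ?subn_gt0 // (le_trans sa).
Qed.

(* Otherwise [robust_weights] applies to [L] copies of the node [P]. *)
Lemma captured (R : realType) (m n t b C L Q : nat) (F : {set cube m n}) (h th : R)
    (B : nat -> {set 'I_n}) (P : {set 'I_n * 'I_m}) :
  avoiding_pred t F -> regime m t b C h th B -> (L * (2 * t + C) <= Q)%N ->
  2 * h <= L%:R -> (#|P| < t)%N ->
  exists J : {set 'I_n * 'I_m}, [/\ (#|J| <= Q)%N, [disjoint J & P] &
    mu R (off F P J) * m%:R ^+ #|P| < h ^- C].
Proof.
move=> av reg LQ hL Pt.
pose ok (J : {set 'I_n * 'I_m}) := [&& (#|J| <= Q)%N, [disjoint J & P] &
    mu R (off F P J) * m%:R ^+ #|P| < h ^- C].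
case: (pickP ok) => [J /and3P[? ? ?]|nok]; first by exists J.
have h2 := reg_h reg; have h0 : 0 < h by apply: lt_trans h2.
have h1 : 1 < h by apply: lt_trans h2; rewrite ltr1n.
have [] := @robust_weights R m n t b C L Q F h th B (fun _ => P) (fun _ => h ^- C) av reg LQ.
- by move=> _; exact: ltnW.
- by move=> i j _; rewrite setIid.
- by [].
- by move=> _ J JQ dJ; have := nok J; rewrite /ok JQ dJ /= => /negbT; rewrite -leNgt.
move=> a [a0 ha sa]; exfalso.
(* A weight at most 1/h would give 2 a_j^(b-t-C) < h^-C, because h > 2 and b - t - C > C; then L >=
   2 h weights sum to at least 2, above 3/2. *)
have la j : h^-1 < a j.
  rewrite ltNge; apply/negP => aj; have := ha j; rewrite leNgt => /negP; apply.
  apply: le_lt_trans (_ : 2 * h^-1 ^+ (b - (t + C)) < _).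
    by rewrite ler_pM2l ?ltr0n // lerXn2r // ?nnegrE ?invr_ge0 // ltW.
  apply: lt_le_trans (_ : h * h^-1 ^+ (b - (t + C)) <= _).
    by rewrite ltr_pM2r // exprn_gt0 // invr_gt0.
  have -> : (b - (t + C) = (b - (t + C)).-1.+1)%N by have := reg_b reg; clear; lia.
  rewrite exprS mulrA divff ?lt0r_neq0 // mul1r -exprVn; apply: ler_wiXn2l.
  - by rewrite invr_ge0 ltW.
  - by rewrite invf_le1 // ltW.
  - have := reg_b reg; clear; lia.
have : \sum_(j < L) h^-1 <= \sum_j a j by apply: ler_sum => j _; exact: ltW.
rewrite sumr_const card_ord -mulr_natl => h3.
have : 2 <= L%:R * h^-1 by rewrite ler_pdivlMr.
lra.
Qed.

Lemma mu_setU (R : realType) (m n : nat) (X Y : {set cube m n}) :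
  mu R (X :|: Y) <= mu R X + mu R Y.
Proof.
by rewrite /mu -mulrDl ler_wpM2r ?invr_ge0 // -natrD ler_nat leq_card_setU.
Qed.

Lemma mu_bigcup (R : realType) (m n : nat) (I : finType) (Q : pred I) (X : I -> {set cube m n}) :
  mu R (\bigcup_(i | Q i) X i) <= \sum_(i | Q i) mu R (X i).
Proof.
rewrite /mu -mulr_suml ler_wpM2r ?invr_ge0 // -natr_sum ler_nat; exact: card_bigcup_le.
Qed.

(** Induction on r: a node P with fewer than t literals is replaced by its children v |: P, for v in
    the at most Q literals capturing F there. Each node loses measure at most h^-C. *)
Lemma exists_cover (R : realType) (m n t b C L Q : nat) (F : {set cube m n}) (h th : R)
    (B : nat -> {set 'I_n}) (r : nat) :
  avoiding_pred t F -> regime m t b C h th B -> (0 < Q)%N -> (L * (2 * t + C) <= Q)%N ->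
  2 * h <= L%:R -> (r <= t)%N ->
  exists S : {set {set 'I_n * 'I_m}}, [/\ (#|S| <= Q ^ r)%N,
    forall P, P \in S -> #|P| = r &
    mu R (F :\: \bigcup_(P in S) link F P) <= r%:R * Q%:R ^+ r * h ^- C].
Proof.
move=> av reg Q0 LQ hL.
have h0 : 0 < h by apply: lt_trans (reg_h reg).
have m1 : 1 <= m%:R :> R by rewrite ler1n (reg_m reg).
elim: r => [_|r IH rt].
  exists [set set0]; split=> [|P|]; rewrite ?cards1 //.
    by rewrite inE => /eqP ->; rewrite cards0.
  rewrite !mul0r big_set1; have -> : link F set0 = F.
    by apply/setP => x; rewrite inE sub0set andbT.
  by rewrite setDv /mu cards0 mul0r.
have [S [cS hS muS]] := IH (ltnW rt).
have [J HJ] : exists J : {set 'I_n * 'I_m} -> {set 'I_n * 'I_m},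
    forall P : {set 'I_n * 'I_m}, (#|P| < t)%N ->
    [/\ (#|J P| <= Q)%N, [disjoint J P & P] & mu R (off F P (J P)) * m%:R ^+ #|P| < h ^- C].
  apply: (fin_all_exists (P := fun P JP : {set 'I_n * 'I_m} => (#|P| < t)%N ->
    [/\ (#|JP| <= Q)%N, [disjoint JP & P] & mu R (off F P JP) * m%:R ^+ #|P| < h ^- C])) => P.
  case: (ltnP #|P| t) => Pt; last by exists set0.
  by have [J HJ] := captured av reg LQ hL Pt; exists J.
have St P : P \in S -> (#|P| < t)%N by move=> /hS ->.
exists (\bigcup_(P in S) [set v |: P | v in J P]); split.
- apply: leq_trans (card_bigcup_le _ _) _.
  apply: leq_trans (_ : \sum_(P in S) Q <= _)%N; last first.
    by rewrite sum_nat_const expnS mulnC leq_mul2l cS orbT.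
  apply: leq_sum => P PS; apply: leq_trans (leq_imset_card _ _) _.
  by have [] := HJ P (St P PS).
- move=> P' /bigcupP[P PS /imsetP[v vJ ->]]; have [_ dJ _] := HJ P (St P PS).
  by rewrite cardsU1 (disjointFr dJ vJ) (hS P PS).
set S' := \bigcup_(P in S) _.
have sub : F :\: \bigcup_(P in S') link F P \subset
    (F :\: \bigcup_(P in S) link F P) :|: \bigcup_(P in S) off F P (J P).
  apply/subsetP => x /setDP[xF nx]; rewrite inE.
  have [/bigcupP[P PS xP]|nx'] := boolP (x \in \bigcup_(P in S) link F P); last first.
    by rewrite inE xF nx'.
  apply/orP; right; apply/bigcupP; exists P => //; rewrite inE xP /=.
  rewrite disjoints_subset; apply/subsetP => v vJ; rewrite inE; apply: contra nx => vx.
  apply/bigcupP; exists (v |: P).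
    by apply/bigcupP; exists P => //; apply: imset_f.
  by apply/linkP; split=> //; rewrite subUset sub1set vx; case/linkP: xP.
apply: le_trans (mu_subset R sub) (le_trans (mu_setU _ _ _) _).
have b1 : mu R (\bigcup_(P in S) off F P (J P)) <= Q%:R ^+ r * h ^- C.
  apply: le_trans (mu_bigcup _ _ _) _.
  apply: le_trans (_ : \sum_(P in S) h ^- C <= _).
    apply: ler_sum => P PS; have [_ _ hP] := HJ P (St P PS).
    apply: le_trans (ltW hP); apply: ler_peMr; first exact: mu_ge0.
    exact: exprn_ege1.
  rewrite sumr_const -[leLHS]mulr_natl ler_wpM2r ?invr_ge0 ?exprn_ge0 ?(ltW h0) //.
  by rewrite -natrX ler_nat.
apply: le_trans (lerD muS b1) _.
have -> : r%:R * Q%:R ^+ r * h ^- C + Q%:R ^+ r * h ^- C = r.+1%:R * (Q%:R ^+ r * h ^- C).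
  by rewrite -natr1; ring.
rewrite -!mulrA ler_wpM2l // ler_wpM2r ?invr_ge0 ?exprn_ge0 ?(ltW h0) //.
by rewrite exprSr ler_peMr ?exprn_ge0 // ler1n.
Qed.

(** * Isolating one dominant subcube *)

(** A weight other than the largest is at most half the total, hence at most 3/4. *)
Lemma sum_pow_but_max (R : realType) (I : finType) (a : I -> R) (k : nat) (i0 : I) :
  (forall i, 0 <= a i) -> \sum_i a i <= 3 / 2 ->
  exists i1, \sum_(i | i != i1) a i ^+ k.+1 <= 3 / 2 * (3 / 4) ^+ k.
Proof.
move=> a0 sa; have [i1 _ max1] := @arg_maxP _ R _ i0 predT a erefl.
exists i1.
have le34 i : i != i1 -> a i <= 3 / 4.
  move=> ii1; have : a i <= a i1 by exact: max1.
  move: sa; rewrite (bigD1 i1) //= (bigD1 i) //=.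
  have : 0 <= \sum_(j | (j != i1) && (j != i)) a j by exact: sumr_ge0.
  lra.
apply: le_trans (_ : \sum_(i | i != i1) a i * (3 / 4) ^+ k <= _).
  apply: ler_sum => i ii1; rewrite exprS ler_wpM2l //.
  by rewrite lerXn2r ?nnegrE ?le34 ?divr_ge0.
rewrite -mulr_suml ler_wpM2r ?exprn_ge0 ?divr_ge0 //.
by apply: le_trans sa; rewrite [leRHS](bigD1 i1) //= lerDr.
Qed.

(** Deleting one literal costs relative density at most 1/m, so q of them cost at most half of a
    heavy density. *)
Lemma heavy_robust (R : realType) (m n q : nat) (F : {set cube m n})
    (P J : {set 'I_n * 'I_m}) :
  (0 < m)%N -> (#|J| <= q)%N -> [disjoint J & P] ->
  2 * q%:R / m%:R <= mu R (link F P) * m%:R ^+ #|P| ->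
  mu R (link F P) * m%:R ^+ #|P| / 2 <= mu R (off F P J) * m%:R ^+ #|P|.
Proof.
move=> m0 Jq dJ heavy.
have mR : 0 < m%:R :> R by rewrite ltr0n.
have sub : link F P \subset off F P J :|: \bigcup_(v in J) link F (v |: P).
  apply/subsetP => x xP; rewrite !inE; move/linkP: (xP) => [xF Px]; rewrite xF Px /=.
  have [//|nd] := boolP [disjoint J & lits x]; apply/bigcupP.
  move: nd; rewrite -setI_eq0 => /set0Pn[v /setIP[vJ vx]]; exists v => //.
  by apply/linkP; rewrite subUset sub1set vx.
have b1 : mu R (\bigcup_(v in J) link F (v |: P)) * m%:R ^+ #|P| <= q%:R / m%:R.
  apply: le_trans (ler_wpM2r _ (mu_bigcup _ _ _)) _; first by rewrite exprn_ge0.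
  rewrite ler_pdivlMr // -mulrA -exprSr mulr_suml.
  apply: le_trans (_ : \sum_(v in J) 1 <= _); last by rewrite sumr_const ler_nat.
  apply: ler_sum => v vJ; have := mu_link_le R F (v |: P).
  by rewrite cardsU1 (disjointFr dJ vJ).
have mp : 0 <= m%:R ^+ #|P| :> R by rewrite exprn_ge0.
have := ler_wpM2r mp (le_trans (mu_subset R sub) (mu_setU _ _ _)).
by rewrite mulrDl; move: heavy; rewrite -mulrA; lra.
Qed.

(** The three errors are the points missed by the cover, the light subcubes of the cover, and the
    heavy ones other than that of largest weight. *)
Lemma almost_junta (R : realType) (m n t b C L Q : nat) (F : {set cube m n}) (h th : R)
    (B : nat -> {set 'I_n}) :
  avoiding_pred t F -> regime m t b C h th B -> (0 < Q)%N -> (L * (2 * t + C) <= Q)%N ->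
  2 * h <= L%:R -> m%:R <= h ^+ C -> (0 < 2 * t + C)%N ->
  exists (P : {set 'I_n * 'I_m}) (x : cube m n), [/\ P \subset lits x, #|P| = t &
    mu R (F :\: link F P) <= t%:R * Q%:R ^+ t * h ^- C +
      (2 * (2 * t + C)%:R * Q%:R ^+ (2 * t) / m%:R + 6 * (3 / 4) ^+ (b - (t + C)).-1) * m%:R ^- t].
Proof.
move=> av reg Q0 LQ hL mC tC0.
have h0 : 0 < h by apply: lt_trans (reg_h reg).
have mR : 0 < m%:R :> R by rewrite ltr0n (reg_m reg).
have [S [cS hS muS]] := exists_cover av reg Q0 LQ hL (leqnn t).
(* The number of deletions [robust_weights] asks for with up to Q^t nodes. *)
pose q := (Q ^ t * (2 * t + C))%N.
pose H := [set P in S | 2 * q%:R / m%:R <= mu R (link F P) * m%:R ^+ t].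
have HS P : P \in H -> P \in S by rewrite inE => /andP[].
have light (X : {set cube m n}) :
    mu R (F :\: X) <= t%:R * Q%:R ^+ t * h ^- C + 2 * (2 * t + C)%:R * Q%:R ^+ (2 * t) / m%:R * m%:R ^- t
      + \sum_(P in H | ~~ (link F P \subset X)) mu R (link F P).
  have sub : F :\: X \subset (F :\: \bigcup_(P in S) link F P) :|: \bigcup_(P in S :\: H) link F P
      :|: \bigcup_(P in H | ~~ (link F P \subset X)) link F P.
    apply/subsetP => x /setDP[xF nx]; rewrite 2!inE -orbA.
    have [/bigcupP[P PS xP]|nx'] := boolP (x \in \bigcup_(P in S) link F P); last first.
      by rewrite inE xF nx'.
    apply/orP; right; have [PH|PH] := boolP (P \in H).
      apply/orP; right; apply/bigcupP; exists P => //; rewrite PH /=.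
      by apply: contra nx => /subsetP; apply.
    by apply/orP; left; apply/bigcupP; exists P; rewrite // inE PH.
  apply: le_trans (mu_subset R sub) _; apply: le_trans (mu_setU _ _ _) _.
  apply: lerD (mu_bigcup _ _ _); apply: le_trans (mu_setU _ _ _) _; apply: lerD muS _.
  apply: le_trans (mu_bigcup _ _ _) _.
  apply: le_trans (_ : \sum_(P in S :\: H) 2 * q%:R / m%:R / m%:R ^+ t <= _).
    apply: ler_sum => P /setDP[PS]; rewrite inE PS /= -ltNge => /ltW lP.
    by rewrite ler_pdivlMr ?exprn_gt0.
  rewrite sumr_const -[leLHS]mulr_natl.
  have -> : 2 * (2 * t + C)%:R * Q%:R ^+ (2 * t) / m%:R * m%:R ^- t =
      Q%:R ^+ t * (2 * q%:R / m%:R / m%:R ^+ t) :> R.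
    have -> : Q%:R ^+ (2 * t) = Q%:R ^+ t * Q%:R ^+ t :> R by rewrite -exprD addnn mul2n.
    by rewrite /q natrM natrX; ring.
  apply: ler_wpM2r; first by rewrite !mulr_ge0 ?invr_ge0 ?exprn_ge0.
  rewrite -natrX ler_nat; apply: leq_trans cS.
  exact/subset_leq_card/subsetDl.
have eD (u v w z : R) : u + (v + w) * z = u + v * z + w * z by rewrite mulrDl addrA.
(* Without heavy subcubes the bound [light] has no last sum, whatever X is, so any t literals of any
   point serve. *)
have [H0|[P1 P1H]] := set_0Vmem H.
  have [x _] : exists x : cube m n, true.
    by exists [ffun => Ordinal (reg_m reg)].
  have tn : (t <= #|lits x|)%N.
    by rewrite card_lits; apply: leq_trans (leq_addr C t) (reg_bn reg).
  have : (0 < #|[set P : {set 'I_n * 'I_m} | (P \subset lits x) && (#|P| == t)]|)%N.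
    by rewrite cards_draws bin_gt0.
  rewrite card_gt0 => /set0Pn[P]; rewrite inE => /andP[Px /eqP Pt].
  exists P, x; split=> //; apply: le_trans (light _) _.
  rewrite big1 ?addr0 => [|P']; last by rewrite H0 inE.
  by rewrite [leRHS]eD lerDl !mulr_ge0 ?invr_ge0 ?exprn_ge0 ?divr_ge0.
pose P0 (j : 'I_#|H|) := enum_val j.
have P0H j : P0 j \in H by exact: enum_valP.
have P0t j : #|P0 j| = t by apply: hS; exact: HS.
have q0 : (0 < q)%N by rewrite /q muln_gt0 expn_gt0 Q0.
have [] := @robust_weights R m n t b C #|H| q F h th B P0
  (fun j => mu R (link F (P0 j)) * m%:R ^+ t / 2) av reg.
- rewrite /q leq_mul2r; apply/orP; right; apply: leq_trans cS.
  by apply/subset_leq_card/subsetP.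
- by move=> j; rewrite P0t.
- move=> i j ij; rewrite -(P0t i) ltn_neqAle subset_leq_card ?subsetIl // andbT.
  apply: contra ij => /eqP e; apply/eqP/enum_val_inj; apply/eqP.
  rewrite eqEcard !P0t leqnn andbT.
  have /setIidPl : P0 i :&: P0 j = P0 i by apply/eqP; rewrite eqEcard subsetIl e leqnn.
  by [].
(* Half of a heavy density is at least q/m >= 1/m >= h^-C. *)
- move=> j; have := P0H j; rewrite inE => /andP[_ hj].
  rewrite ler_pdivlMr ?ltr0n //; apply: le_trans hj; rewrite mulrC -mulrA ler_pM2l ?ltr0n //.
  apply: le_trans (_ : m%:R^-1 <= _); last by rewrite ler_peMl ?invr_ge0 // ler1n.
  by rewrite lef_pV2 ?posrE ?exprn_gt0.
- move=> j J Jq dJ; have := heavy_robust (R := R) (F := F) (reg_m reg) Jq dJ.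
  rewrite P0t; apply.
  by have := P0H j; rewrite inE => /andP[].
move=> a [a0 ha sa].
have [j1 hj1] := sum_pow_but_max (b - (t + C)).-1 (enum_rank_in P1H P1) a0 sa.
have bk : (b - (t + C)).-1.+1 = (b - (t + C))%N.
  by have := reg_b reg; clear; lia.
rewrite bk in hj1.
have [x xP] : exists x, x \in link F (P0 j1).
  apply/set0Pn; apply: contraTneq (P0H j1) => e; rewrite inE e /mu cards0 !mul0r negb_and -ltNge.
  by rewrite divr_gt0 ?orbT // mulr_gt0 ?ltr0n.
exists (P0 j1), x; split=> //; first by case/linkP: xP.
apply: le_trans (light _) _.
rewrite [leRHS]eD lerD2l.
rewrite ler_pdivlMr ?exprn_gt0 // mulr_suml.
apply: le_trans (_ : \sum_(P in H | P != P0 j1) mu R (link F P) * m%:R ^+ t <= _).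
  rewrite big_mkcond [leRHS]big_mkcond; apply: ler_sum => P _.
  have [PH|//] := boolP (P \in H); case: eqP => [->|_] /=; first by rewrite subxx.
  by case: ifP => // _; rewrite mulr_ge0 ?mu_ge0 ?exprn_ge0.
(* The density is at most 4 a_j^(b-t-C), and 4 times 3/2 is the constant 6. *)
apply: le_trans (_ : \sum_(j | j != j1) 4 * a j ^+ (b - (t + C)) <= _); last first.
  by rewrite -mulr_sumr; move: hj1; lra.
rewrite (reindex_onto P0 (enum_rank_in P1H)) /=; last first.
  by move=> P /andP[PH _]; rewrite /P0 enum_rankK_in.
apply: le_trans (_ : \sum_(j | j != j1) mu R (link F (P0 j)) * m%:R ^+ t <= _).
  rewrite le_eqVlt; apply/orP; left; apply/eqP; apply: eq_bigl => j.
  rewrite P0H /= /P0 enum_valK_in eqxx andbT; apply: negb_inj; rewrite !negbK.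
  by apply/eqP/eqP => [/enum_val_inj|->].
by apply: ler_sum => j _; have := ha j; lra.
Qed.

(** * Choice of the parameters *)

(** With s the quotient of n by 2 k, n <= 2 k (s + 1) <= 2^s 2^s, and the k-th power of this is at
    most 2^n. *)
Lemma poly_le_exp (k n : nat) : (4 * k ^ 2 <= n)%N -> (n ^ k <= 2 ^ n)%N.
Proof.
have [->|k0] := posnP k; first by rewrite expn_gt0.
move=> nk; pose s := (n %/ (2 * k))%N.
have k2 : (0 < 2 * k)%N by rewrite muln_gt0.
have ks : (2 * k <= s)%N by rewrite leq_divRL //; apply: leq_trans nk; rewrite expnS expn1; lia.
have ns : (n <= 2 * k * s.+1)%N by rewrite mulnC ltnW // ltn_ceil.
have sn : (2 * k * s <= n)%N by rewrite mulnC leq_trunc_div.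
apply: leq_trans (_ : 2 ^ (2 * k * s) <= _)%N; last by rewrite leq_pexp2l.
have -> : (2 * k * s = (s + s) * k)%N by lia.
rewrite expnM leq_exp2r // expnD; apply: leq_trans ns _; apply: leq_mul; last exact: ltn_expl.
by apply: leq_trans ks (ltnW (ltn_expl _ _)).
Qed.

(** Consecutive runs of t coordinates, complete for l < n %/ t. *)
Definition block (n t l : nat) : {set 'I_n} := [set i : 'I_n | (i %/ t == l)%N].

Lemma leq_card_block (n t l : nat) : (l < n %/ t)%N -> (t <= #|block n t l|)%N.
Proof.
move=> ln.
have t0 : (0 < t)%N by case: t ln => //; rewrite divn0.
have b (i : 'I_t) : (l * t + i < n)%N.
  have : (l.+1 * t <= n)%N by rewrite -leq_divRL.
  by apply: leq_trans; rewrite mulSn addnC ltn_add2r.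
rewrite -[leqLHS](card_ord t) -(card_imset _ (f := fun i => Ordinal (b i))); last first.
  by move=> i j [] /addnI /val_inj.
apply/subset_leq_card/subsetP => _ /imsetP[i _ ->].
by rewrite inE /= divnMDl // divn_small ?addn0.
Qed.

Lemma disjoint_block (n t l l' : nat) : l != l' -> [disjoint block n t l & block n t l'].
Proof.
move=> ll'; rewrite disjoints_subset; apply/subsetP => i; rewrite !inE => /eqP ->.
exact: ll'.
Qed.

(** The condition [reg_num] becomes 2 t n^(t+1) h^(k+1) < m for k < t. It follows from 2 t <= n,
    n^(t+3) <= h and m = h^e with e > t. *)
Lemma regime_block (R : realType) (m n t e C : nat) (h : R) :
  (0 < t)%N -> (t < e)%N -> m%:R = h ^+ e -> n%:R ^+ (t + 3) <= h ->
  (t * (3 * (16 + t + C)) <= n)%N ->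
  regime m t (n %/ t) C h (((2 * t * n ^ t)%:R)^-1) (block n t).
Proof.
move=> t0 te mh nh nn.
have bn : (3 * (16 + t + C) <= n %/ t)%N by rewrite leq_divRL // mulnC.
have n48 : (48 + 3 * t + 3 * C <= n)%N by apply: leq_trans (leq_div _ t); lia.
have nR : 48 + 3 * t%:R + 3 * C%:R <= n%:R :> R by rewrite -!natrM -!natrD ler_nat.
have t0R : 0 < t%:R :> R by rewrite ltr0n.
have C0R : 0 <= C%:R :> R by [].
have n0 : 0 < n%:R :> R by lra.
have n1 : 1 <= n%:R :> R by lra.
have hn : n%:R <= h by apply: le_trans nh; rewrite addn3 ler_eXnr.
have h0 : 0 < h by apply: lt_le_trans hn.
have h1 : 1 <= h by apply: le_trans hn.
have m0 : 0 < m%:R :> R by rewrite mh exprn_gt0.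
have w0 : 0 < (2 * t * n ^ t)%:R :> R.
  by rewrite ltr0n !muln_gt0 /= expn_gt0 t0 -(ltr0n R) n0.
split.
- by rewrite -(ltr0n R).
- by rewrite -(ltr0n R).
- by apply: lt_le_trans hn; lra.
- by rewrite invr_ge0 ltW.
- by rewrite mulVf // gt_eqF.
- move=> k kt; rewrite ltr_pdivlMl // expr_div_n ltr_pdivlMr ?exprn_gt0 //.
  have -> : (2 * t * n ^ t)%:R * (n%:R * m%:R ^+ k) * h ^+ k.+1 =
      (2 * t%:R * (n%:R * n%:R ^+ t) * h ^+ k.+1) * m%:R ^+ k.
    by rewrite !natrM natrX; ring.
  rewrite [ltRHS]exprS ltr_pM2r ?exprn_gt0 //.
  apply: le_lt_trans (_ : n%:R * (n%:R * n%:R ^+ t) * h ^+ t < _).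
    apply: ler_pM; rewrite ?mulr_ge0 ?exprn_ge0 ?(ltW h0) //.
      by rewrite ler_wpM2r ?mulr_ge0 ?exprn_ge0 //; lra.
    by rewrite ler_weXn2l.
  apply: lt_le_trans (_ : h * h ^+ t <= _); last by rewrite mh -exprS ler_weXn2l.
  rewrite ltr_pM2r ?exprn_gt0 //; apply: lt_le_trans nh.
  by rewrite -!exprS addn3 ltr_eXn2l //; lra.
- by move=> l lb; rewrite leqW // leq_card_block.
- by move=> l l' _ _ ll'; apply: disjoint_block.
- by move: bn; clear; lia.
- by move: n48; clear; lia.
Qed.

(** With g = 2^(n/K), each summand is at most 1/(2g): K >= N e gives g <= h, and K >= 6 t leaves at
    least 3 w factors 3/4, where 2^w >= 16 g. *)
Lemma final_bound (R : realType) (n t c N K e : nat) (h : R) :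
  (0 < t)%N -> (0 < K)%N -> (N * e <= K)%N -> (6 * t <= K)%N ->
  4 <= h -> 2 ^+ n <= h ^+ (N * e) -> (t * (3 * (16 + c)) <= n)%N ->
  2 * h ^- 2 + 6 * (3 / 4) ^+ (n %/ t - c).-1 <= 2 `^ (- (n%:R / K%:R)).
Proof.
move=> t0 K0 NeK tK h4 hn nn; rewrite powRN.
set g := 2 `^ (n%:R / K%:R).
have h1 : 1 <= h by lra.
have h0 : 0 < h by lra.
have g0 : 0 < g by exact: powR_gt0.
have gK : g ^+ K = 2 ^+ n.
  by rewrite -powR_mulrn ?powR_ge0 // /g -powRrM divfK ?pnatr_eq0 -?lt0n // powR_mulrn.
have gh : g <= h.
  rewrite -(ler_pXn2r K0) ?nnegrE ?(ltW g0) ?(ltW h0) // gK; apply: le_trans hn _.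
  by rewrite ler_weXn2l.
have b1 : 2 * h ^- 2 <= g^-1 / 2.
  apply: le_trans (_ : h^-1 / 2 <= _); last first.
    by rewrite ler_wpM2r // lef_pV2 ?posrE.
  rewrite ler_pdivlMr // expr2 invfM; have : h^-1 <= 4^-1 by rewrite lef_pV2 ?posrE.
  have : 0 < h^-1 by rewrite invr_gt0.
  nra.
have b2 : 6 * (3 / 4) ^+ (n %/ t - c).-1 <= g^-1 / 2.
  (* The 5 pays for rounding n/K up and for the factor 16; (3/4)^3 <= 1/2 turns 3 w factors into
     2^-w. *)
  pose w := (n %/ K + 5)%N.
  have wb : (3 * w <= (n %/ t - c).-1)%N.
    have bn : (3 * (16 + c) <= n %/ t)%N by rewrite leq_divRL // mulnC.
    have : (n %/ K <= n %/ t %/ 6)%N by rewrite -divnMA mulnC leq_div2l // muln_gt0 t0.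
    rewrite /w; move: (n %/ K)%N (n %/ t)%N bn => u v; clear; lia.
  have gw : 16 * g <= 2 ^+ w.
    have -> : w = ((n %/ K).+1 + 4)%N by rewrite /w; lia.
    rewrite exprD [leRHS]mulrC (_ : 2 ^+ 4 = 16) ?ler_pM2l //; last by ring.
    rewrite -(ler_pXn2r K0) ?nnegrE ?exprn_ge0 ?(ltW g0) // gK -exprM ler_weXn2l ?ler1n //.
    by rewrite ltnW // ltn_ceil.
  apply: le_trans (_ : 6 * (3 / 4) ^+ (3 * w) <= _).
    by rewrite ler_pM2l // ler_wiXn2l // ?divr_ge0 //; lra.
  rewrite exprM; apply: le_trans (_ : 6 * (2^-1) ^+ w <= _).
    rewrite ler_pM2l // lerXn2r ?nnegrE ?exprn_ge0 ?divr_ge0 ?invr_ge0 //.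
    by rewrite !exprS expr0; lra.
  rewrite exprVn; apply: le_trans (_ : 6 * (16 * g)^-1 <= _).
    by rewrite ler_pM2l // lef_pV2 ?posrE ?exprn_gt0 ?mulr_gt0.
  rewrite invfM; have : 0 < g^-1 by rewrite invr_gt0.
  lra.
lra.
Qed.

(** C = e (t + 1) makes h^C = m^(t+1), so the uncovered part gains a factor 1/m over m^-t; e >= 4 t
    + 3 lets m absorb h Q^(2t) <= h^(4t+1) with h^-2 to spare. *)
Lemma avoiding_almost_link (R : realType) (m n t N : nat) (F : {set cube m n}) (h : R) :
  let e := (6 * t + 4)%N in let C := (e * t.+1)%N in
  (0 < t)%N -> (0 < N)%N -> avoiding_pred t F ->
  m%:R = h ^+ e -> n%:R ^+ (t + 3) <= h -> 2 ^+ n <= h ^+ (N * e) ->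
  (t * (3 * (16 + t + C)) + 3 * (2 * t + C) <= n)%N ->
  exists (P : {set 'I_n * 'I_m}) (x : cube m n), [/\ P \subset lits x, #|P| = t &
    mu R (F :\: link F P) <= 2 `^ (- (n%:R / (6 * t * (N * e))%:R)) * m%:R ^- t].
Proof.
move=> e C t0 N0 av mh nh hn nn.
have te : (t < e)%N by rewrite /e; lia.
have nn1 : (t * (3 * (16 + t + C)) <= n)%N by apply: leq_trans nn; rewrite leq_addr.
have reg := regime_block t0 te mh nh nn1.
have h2 := reg_h reg; have h0 : 0 < h by lra.
have h1 : 1 <= h by lra.
have n3 : 3 * (2 * t + C)%:R <= n%:R :> R.
  by rewrite -natrM ler_nat; apply: leq_trans nn; rewrite leq_addl.
have n48 : (48 <= n)%N.
  apply: leq_trans nn1; apply: leq_trans (leq_pmull _ t0); rewrite -!addnA mulnDr.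
  exact: leq_addr.
have n1 : 1 <= n%:R :> R by rewrite ler1n; apply: leq_trans n48.
have nhR : n%:R <= h by apply: le_trans nh; rewrite addn3 ler_eXnr.
have h4 : 4 <= h by apply: le_trans nhR; rewrite ler_nat (leq_trans _ n48).
have m0 : 0 < m%:R :> R by rewrite mh exprn_gt0.
pose L := (Num.truncn (2 * h)).+1.
have hL : 2 * h <= L%:R by rewrite /L ltW // truncnS_gt.
have Lh : L%:R <= 3 * h.
  have := truncn_le (2 * h); rewrite mulr_ge0 ?(ltW h0) // /L -natr1 => ?; lra.
have tC0 : (0 < 2 * t + C)%N by rewrite ltn_addr // muln_gt0.
pose Q := (L * (2 * t + C))%N.
have Q0 : (0 < Q)%N by rewrite muln_gt0.
(* Combine L <= 3 h with 3 (2 t + C) <= n <= h. *)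
have Qh : Q%:R <= h ^+ 2.
  rewrite natrM expr2; apply: le_trans (_ : (3 * h) * (n%:R / 3) <= _).
    by apply: ler_pM => //; lra.
  by rewrite (_ : _ * _ = h * n%:R) ?ler_pM2l //; field.
have mC : m%:R <= h ^+ C by rewrite mh /C ler_weXn2l // leq_pmulr.
have [P [x [Px Pt bd]]] := almost_junta av reg Q0 (leqnn _) hL mC tC0.
exists P, x; split=> //; apply: le_trans bd _.
have hC : h ^- C = m%:R^-1 * m%:R ^- t.
  by rewrite /C exprM -mh exprS invfM.
have QT k : Q%:R ^+ k <= h ^+ (2 * k).
  by rewrite exprM lerXn2r // nnegrE ?exprn_ge0 ?(ltW h0).
have small u k : 0 <= u -> u <= h -> (2 * k + 3 <= e)%N -> u * Q%:R ^+ k / m%:R <= h ^- 2.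
  move=> u0 uh ke; rewrite ler_pdivrMr // [leRHS]mulrC ler_pdivlMr ?exprn_gt0 //.
  apply: le_trans (_ : h * h ^+ (2 * k) * h ^+ 2 <= _).
    rewrite ler_pM2r ?exprn_gt0 //; exact: ler_pM.
  by rewrite -exprS -exprD mh ler_weXn2l // ; move: ke; clear; lia.
have s1 : t%:R * Q%:R ^+ t / m%:R <= h ^- 2.
  apply: small => //; last by rewrite /e; clear; lia.
  have tn : t%:R <= n%:R :> R.
    by rewrite ler_nat; apply: leq_trans nn1; rewrite leq_pmulr.
  exact: le_trans tn nhR.
have s2 : 2 * (2 * t + C)%:R * Q%:R ^+ (2 * t) / m%:R <= h ^- 2.
  apply: small => //; last by rewrite /e; clear; lia.
  by have : 0 <= (2 * t + C)%:R :> R by []; lra.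
rewrite hC mulrA -mulrDl ler_wpM2r ?invr_ge0 ?exprn_ge0 //.
rewrite addrA; apply: le_trans (final_bound (c := t + C) (N := N) (e := e) (h := h) t0 _ _ _ h4 hn _).
- by rewrite lerD2r; move: s1 s2; lra.
- by rewrite !muln_gt0 t0 N0 /e addn4.
- by rewrite leq_pmull // muln_gt0 t0.
- by rewrite leq_pmulr // muln_gt0 N0 /e addn4.
- by rewrite addnA.
Qed.

Theorem theorem7p14 (t N : nat) (HN : (0 < N)%N) :
  exists K n0 : nat, (0 < K)%N /\
    forall (R : realType) (m n : nat) (F : {set cube m n}),
      avoiding_pred t F -> (n0 <= n)%N ->
      (2 : R) `^ (n%:R / N%:R) <= m%:R ->
      exists (Rs : {set 'I_n}) (alpha : cube m n),
        #|Rs| = t /\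
        mu R (F :\: subcube Rs alpha) <=
          (2 : R) `^ (- (n%:R / K%:R)) * (m%:R ^- t).
Proof.
(* For t = 0 the subcube with no fixed coordinate is the whole cube and nothing is left over. *)
have [->|t0] := posnP t.
  exists 1%N, 0%N; split=> // R m n F _ _ mn.
  have m0 : (0 < m)%N by rewrite -(ltr0n R); apply: lt_le_trans mn; exact: powR_gt0.
  exists set0, [ffun => Ordinal m0]; rewrite cards0; split=> //.
  have -> : F :\: subcube set0 [ffun => Ordinal m0] = set0.
    apply/setP => x; rewrite !inE; apply/negbTE; rewrite negb_and negbK.
    by apply/orP; left; apply/forallP => i; rewrite inE.
  by rewrite /mu cards0 mul0r mulr_ge0 ?powR_ge0 // invr_ge0 exprn_ge0.
pose e := (6 * t + 4)%N; pose C := (e * t.+1)%N.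
(* With h the e-th root of m, h^(N e) = m^N >= 2^n, so n^k <= 2^n yields n^(t+3) <= h; the summand 4
   k^2 of the threshold secures it. *)
pose k := ((t + 3) * (N * e))%N.
exists (6 * t * (N * e))%N, (t * (3 * (16 + t + C)) + 3 * (2 * t + C) + 4 * k ^ 2)%N.
have Ne0 : (0 < N * e)%N by rewrite muln_gt0 HN /e addn4.
split=> [|R m n F av nn mn]; first by rewrite !muln_gt0 t0 HN /e addn4.
pose h : R := m%:R `^ (e%:R^-1).
have h0 : 0 <= h by exact: powR_ge0.
have mh : m%:R = h ^+ e.
  by rewrite -powR_mulrn // /h -powRrM mulVf ?powRr1 // pnatr_eq0 /e addn4.
have hn : 2 ^+ n <= h ^+ (N * e).
  rewrite mulnC exprM -mh.
  have -> : 2 ^+ n = (2 `^ (n%:R / N%:R)) ^+ N :> R.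
    by rewrite -[RHS]powR_mulrn ?powR_ge0 // -powRrM divfK ?pnatr_eq0 -?lt0n // powR_mulrn.
  by rewrite lerXn2r // nnegrE ?powR_ge0.
have nh : n%:R ^+ (t + 3) <= h.
  rewrite -(ler_pXn2r Ne0) ?nnegrE ?exprn_ge0 //; apply: le_trans hn.
  rewrite -exprM -!natrX ler_nat; apply: poly_le_exp.
  by apply: leq_trans nn; rewrite leq_addl.
have nn1 := leq_trans (leq_addr _ _) nn.
have [P [x [Px Pt bd]]] := avoiding_almost_link t0 HN av mh nh hn nn1.
exists (dom P), x; split; first by rewrite (card_dom Px).
have -> : F :\: subcube (dom P) x = F :\: link F P; last exact: bd.
apply/setP => y; rewrite !inE; case: (boolP (y \in F)) => yF; rewrite ?andbF //=.
rewrite !andbT; congr (~~ _); apply/forall_inP/litsP => [h' v vP|h' _ /imsetP[v vP ->]].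
  by rewrite (eqP (h' _ (imset_f _ vP))) (litsP _ _ Px).
by rewrite h' // (litsP _ _ Px).
Qed.
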